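(* Let $n\ge 2$ and let $M_0=\{(y,u(|y|)) : y\in\mathbb{R}^n\}\subset\mathbb{R}^{n+1}$ be a convex entire graph over $\mathbb{R}^n$. Suppose that there exist positive constants $\epsilon$, $c$ and $N$ such that $$u'(r)\ge c\,r^{\epsilon}\qquad\text{for all } r\ge N .$$ Then the longtime solution to the mean curvature flow with initial data $M_0$ is Type IIb.
   Context: Hypersurfaces are smooth and complete. A family of immersions $x(\cdot,t):M^n\to\mathbb{R}^{n+1}$ with images $M_t$ solves the mean curvature flow if $\frac{\partial x}{\partial t}=\vec{\mathbf{H}}=-H\nu$, where $\nu$ is the outer unit normal and $H$ the mean curvature (with this convention convex hypersurfaces have $H\ge 0$; for the graph of a convex function $\nu$ points downward). A longtime solution is a smooth solution existing for all $t>0$; by Ecker and Huisken, the mean curvature flow starting from an entire graph over $\mathbb{R}^n$ has a longtime solution (consisting of entire graphs). Let $A(\cdot,t)$ be the second fundamental form of $M_t$. A longtime solution is called Type IIb if $\sup_{M^n\times(0,+\infty)} t|A|^2=\infty$, and Type III if $\sup_{M^n\times(0,+\infty)} t|A|^2<\infty$. *)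

(* Defs.v *)
From HB Require Import structures.
From mathcomp Require Import all_boot all_order all_algebra.
From mathcomp Require Import all_classical all_reals all_analysis.

Set Implicit Arguments.
Unset Strict Implicit.
Unset Printing Implicit Defensive.

Import Order.TTheory GRing.Theory Num.Theory.
Import numFieldNormedType.Exports.

Local Open Scope classical_set_scope.
Local Open Scope ring_scope.

(* The norm of the library on row vectors is the sup norm; the geometry below
   is Euclidean. *)
Definition dot {R : realType} {m : nat} (a b : 'rV[R]_m) : R :=
  \sum_(i < m) a 0 i * b 0 i.

Definition enorm {R : realType} {m : nat} (a : 'rV[R]_m) : R :=
  Num.sqrt (dot a a).

(* C^oo on the open set U: every iterated directional derivative of f exists
   and is Frechet differentiable at every point of U.  All spaces used below
   are finite dimensional. *)
Definition smooth_on {R : realType} {V W : normedModType R}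
    (U : set V) (f : V -> W) : Prop :=
  forall (vs : seq V) (a : V), U a ->
    differentiable (foldr (fun v g => 'D_v g) f vs) a.

Section Hypersurface.
Context {R : realType} {n : nat}.
Implicit Types (f nu : 'rV[R]_n -> 'rV[R]_(n + 1)) (p : 'rV[R]_n).

Definition partial f (i : 'I_n) : 'rV[R]_n -> 'rV[R]_(n + 1) :=
  'D_(delta_mx 0 i) f.

Definition immersion f : Prop :=
  smooth_on setT f /\ forall p, injective ('d f p).

Definition embedding f : Prop :=
  immersion f /\
  exists2 g : 'rV[R]_(n + 1) -> 'rV[R]_n,
    cancel f g & {within range f, continuous g}.

Definition unit_normal f nu : Prop :=
  forall p, enorm (nu p) = 1 /\ forall i, dot (nu p) (partial f i p) = 0.

Definition first_form f p : 'M[R]_n :=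
  \matrix_(i, j) dot (partial f i p) (partial f j p).

(* The sign makes the mean curvature of a round sphere positive with respect
   to the outer normal, and that of the graph of a convex function nonnegative
   with respect to the downward normal. *)
Definition second_form f nu p : 'M[R]_n :=
  \matrix_(i, j) - dot (partial (partial f j) i p) (nu p).

Definition shape_operator f nu p : 'M[R]_n :=
  invmx (first_form f p) *m second_form f nu p.

Definition mean_curvature f nu p : R := \tr (shape_operator f nu p).

(* |A|^2 = g^{ij} g^{kl} h_{jk} h_{li} *)
Definition sqnormA f nu p : R :=
  \tr (shape_operator f nu p *m shape_operator f nu p).

Definition curve_length f (gamma : R -> 'rV[R]_n) : \bar R :=
  (\int[lebesgue_measure]_(s in `[0%R, 1%R])
     (enorm (derive1 (f \o gamma) s))%:E)%E.

(* Distance of the metric induced by f; extending the curves smoothly from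
   [0, 1] to the whole line does not change the infimum. *)
Definition induced_dist f p q : \bar R :=
  ereal_inf [set curve_length f gamma | gamma in
    [set gamma : R -> 'rV[R]_n |
      [/\ smooth_on setT gamma, gamma 0 = p & gamma 1 = q]]].

Definition complete_immersion f : Prop :=
  immersion f /\
  forall w : nat -> 'rV[R]_n,
    (forall e : R, 0 < e -> exists N : nat, forall k l : nat,
       (N <= k)%N -> (N <= l)%N -> (induced_dist f (w k) (w l) < e%:E)%E) ->
    exists p, forall e : R, 0 < e -> exists N : nat, forall k : nat,
       (N <= k)%N -> (induced_dist f (w k) p < e%:E)%E.

Definition entire_graph (U : 'rV[R]_n -> R) : set 'rV[R]_(n + 1) :=
  range (fun y : 'rV[R]_n => row_mx y (U y)%:M).

(* The parameter manifold is R^n, to which an entire graph is diffeomorphic.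
   The solution is smooth for t > 0 and continuous up to t = 0.  Neither
   H nu nor |A|^2 changes when nu is replaced by - nu, so both choices of the
   continuous unit normal, in particular the outer one, are allowed. *)
Record longtime_mcf (x nu : R -> 'rV[R]_n -> 'rV[R]_(n + 1)) : Prop := {
  mcf_continuous :
    {within [set z : R * 'rV[R]_n | 0 <= z.1],
      continuous (fun z : R * 'rV[R]_n => x z.1 z.2)};
  mcf_smooth :
    smooth_on [set z : R * 'rV[R]_n | 0 < z.1]
      (fun z : R * 'rV[R]_n => x z.1 z.2);
  mcf_complete : forall t, 0 <= t -> complete_immersion (x t);
  mcf_normal_continuous :
    {within [set z : R * 'rV[R]_n | 0 < z.1],
      continuous (fun z : R * 'rV[R]_n => nu z.1 z.2)};
  mcf_normal : forall t, 0 < t -> unit_normal (x t) (nu t);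
  mcf_eq : forall t p, 0 < t ->
    derive1 (fun s => x s p) t = - (mean_curvature (x t) (nu t) p *: nu t p)
}.

Definition initial_data (x : R -> 'rV[R]_n -> 'rV[R]_(n + 1))
    (M0 : set 'rV[R]_(n + 1)) : Prop :=
  embedding (x 0) /\ range (x 0) = M0.

Definition typeIIb (x nu : R -> 'rV[R]_n -> 'rV[R]_(n + 1)) : Prop :=
  ereal_sup [set (z.1 * sqnormA (x z.1) (nu z.1) z.2)%:E | z in
    [set z : R * 'rV[R]_n | 0 < z.1]] = +oo%E.

End Hypersurface.

(* Main.v *)
Require Import Defs.
From HB Require Import structures.
From mathcomp Require Import all_boot all_order all_algebra.
From mathcomp Require Import all_classical all_reals all_analysis.
From mathcomp Require Import ring lra.
Import Order.TTheory GRing.Theory Num.Theory.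
Import numFieldNormedType.Exports.
Local Open Scope classical_set_scope.
Local Open Scope ring_scope.

(** Suppose that t |A|^2 is bounded.  Since H^2 <= (n + 1) |A|^2, every point
    moves with speed at most K / sqrt t, hence by at most 2 K sqrt t up to
    time t ([displacement_le]): the solution can only drift at the parabolic
    rate.  A graph that grows faster than linearly is too thin for that.  Seen
    from far above it looks like a cylinder over an (n - 1)-sphere whose radius
    is much smaller than the height, and such a cylinder shrinks away, and so
    forces the tip to rise to that height, within a time comparable to the
    square of the radius.

    The barrier that turns this picture into a proof is
      Phi = |y|^2 - a z^2 + t / 2,
    where y and z are the horizontal and vertical coordinates in R^(n+1) and
    a > 0 is a small constant.  On a hypersurface with unit normal nu, the trace
    over the tangent space of the quadratic form |y|^2 - a z^2 is
      n - 1 - a + (1 + a) nu_z^2,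
    which is at least 1/2 because n >= 2.  Hence along the flow
    (d/dt - Laplacian) Phi <= 1/2 - 2 (1/2) < 0, so at a positive time
    Phi cannot reach its maximum over all points and all times up to then
    ([barrier_no_late_max]).  Superlinear growth of u makes Phi bounded above at
    time 0 and, combined with the displacement bound, makes Phi tend to minus
    infinity at spatial infinity, uniformly on bounded time intervals.  Hence
    the maximum over a bounded time interval is attained, and Phi stays below
    its initial bound B for all time ([barrier_le]).  But
    follow one point: z^2 <= 2 z_0^2 + 8 K^2 t along its trajectory, hence
      Phi >= t / 2 - a (2 z_0^2 + 8 K^2 t),
    and this is unbounded in t as soon as 8 a K^2 < 1/2: a contradiction.

    The maximum principle is used pointwise.  At a spatial maximum the gradient
    of the quadratic form is normal to the hypersurface and its Hessian is
    nonpositive, which gives a lower bound for H ([mean_curvature_at_max]); the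
    matrix inequalities behind it and behind H^2 <= (n + 1) |A|^2 both come from
    writing the inverse of a Gram matrix as K K^T ([invmx_gram]). *)

(** * Differential calculus *)

Lemma is_derive_line (R : realType) (V W : normedModType R) (f : V -> W)
    (p v : V) (s : R) :
  derivable f (s *: v + p) v ->
  is_derive s 1 (fun h : R => f (h *: v + p)) ('D_v f (s *: v + p)).
Proof.
move=> df.
have E : (fun h : R => h^-1 *: (f ((h *: 1 + s) *: v + p) - f (s *: v + p))) =
         (fun h : R => h^-1 *: (f (h *: v + (s *: v + p)) - f (s *: v + p))).
  by rewrite funeqE => h; rewrite [h *: 1]mulr1 scalerDl addrA.
split; first by rewrite /derivable E.
by rewrite /derive E.
Qed.

Lemma mean_value_pos (R : realType) (phi dphi : R -> R) (h : R) : 0 < h ->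
  (forall s : R, is_derive s 1 phi (dphi s)) ->
  exists2 s, 0 < s < h & phi h - phi 0 = dphi s * h.
Proof.
move=> h0 dphiP.
have cphi : {within `[0, h], continuous phi}.
  apply: continuous_subspaceT => x; apply: differentiable_continuous.
  by apply/derivable1_diffP; case: (dphiP x).
have [s] := MVT h0 (fun x _ => dphiP x) cphi.
by rewrite in_itv /= subr0; exists s.
Qed.

(** If the second derivative were positive at a critical maximum, the first
    derivative would be positive just to the right of it, and the function would
    exceed its maximum there. *)
Lemma second_derivative_at_max (R : realType) (phi dphi : R -> R) (l : R) :
  (forall s : R, is_derive s 1 phi (dphi s)) -> is_derive (0 : R) 1 dphi l ->
  (forall s, phi s <= phi 0) -> dphi 0 = 0 /\ l <= 0.
Proof.
move=> dphiP dl phimax.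
have dphi0 : dphi 0 = 0.
  have h0 : (0 : R) \in `](-1), 1[%R by rewrite in_itv /= ltrN10 ltr01.
  have H : is_derive (0 : R) 1 phi 0.
    by apply: (@derive1_at_max R phi (-1) 1 0).
  by case: (dphiP 0) => _ <-; case: H => _ ->.
split => //; rewrite leNgt; apply/negP => l0.
(* The difference quotients of the first derivative are eventually positive. *)
have : \forall h \near (0 : R)^'+, 0 < h^-1 *: (dphi h - dphi 0).
  have [/cvg_ex [l' cl]] := dl.
  rewrite /derive => El.
  have {}El : l' = l by rewrite -El; apply/esym/cvg_lim.
  rewrite El in cl.
  have cl' : (fun h : R => h^-1 *: (dphi h - dphi 0)) @ (0 : R)^'+ --> l.
    apply: (@cvg_trans _ ((fun h : R => h^-1 *: ((dphi \o shift 0) (h *: 1) - dphi 0)) @ (0 : R)^'+)).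
      apply: near_eq_cvg; apply: nearW => h /=.
      by rewrite [h *: 1]mulr1 addr0.
    apply: cvg_trans cl; apply: cvg_app.
    by move=> A [e /= e0 Ae]; exists e => // x xe x0; apply: Ae => //; rewrite gt_eqF.
  exact: cvgr_gt cl' _ l0.
move=> [d /= d0 Hd].
have pos s : 0 < s < d -> 0 < dphi s.
  move=> /andP[s0 sd].
  have := Hd s; rewrite /= sub0r normrN gtr0_norm // dphi0 subr0 => /(_ sd s0).
  rewrite (_ : s^-1 *: dphi s = s^-1 * dphi s) //.
  by rewrite pmulr_rgt0 // invr_gt0.
have d20 : 0 < d / 2 by rewrite divr_gt0.
have [c /andP[c0 cd] E] := mean_value_pos _ _ _ _ d20 dphiP.
have : 0 < phi (d/2) - phi 0.
  by rewrite E mulr_gt0 // pos // c0 /=; lra.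
by rewrite subr_gt0 ltNge phimax.
Qed.

(** The left side is symmetric in v and w; this is how the mixed second
    difference links the two orders of differentiation. *)
Lemma mixed_difference (R : realType) (V : normedModType R) (g : V -> R)
    (v w p : V) (h : R) : 0 < h ->
  (forall q, derivable g q v) -> (forall q, derivable ('D_v g) q w) ->
  exists s t : R, [/\ 0 < s < h, 0 < t < h &
   g (h *: v + (h *: w + p)) + g p - (g (h *: v + p) + g (h *: w + p)) =
   h ^+ 2 * 'D_w ('D_v g) (t *: w + (s *: v + p))].
Proof.
move=> h0 dg ddg.
pose phi (s : R) := g (s *: v + (h *: w + p)) - g (s *: v + p).
pose dphi (s : R) : R := 'D_v g (s *: v + (h *: w + p)) - 'D_v g (s *: v + p).
have dphiP (s : R) : is_derive s 1 phi (dphi s).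
  by apply: is_deriveB; apply: is_derive_line; apply: dg.
have [s sh E] := mean_value_pos _ _ _ _ h0 dphiP.
pose psi (t : R) : R := 'D_v g (t *: w + (s *: v + p)).
pose dpsi (t : R) : R := 'D_w ('D_v g) (t *: w + (s *: v + p)).
have dpsiP (t : R) : is_derive t 1 psi (dpsi t).
  by apply: is_derive_line; apply: ddg.
have [t th E'] := mean_value_pos _ _ _ _ h0 dpsiP.
exists s, t; split => //.
have -> : g (h *: v + (h *: w + p)) + g p - (g (h *: v + p) + g (h *: w + p)) =
   phi h - phi 0.
  by rewrite /phi !scale0r !add0r opprB opprD addrACA.
rewrite E; have -> : dphi s = psi h - psi 0.
  by rewrite /dphi /psi scale0r add0r addrCA.
by rewrite E' /dpsi; ring.
Qed.

(** Schwarz's theorem.  The second difference over a small parallelogram is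
    h^2 times either mixed derivative at some nearby point, so the two mixed
    derivatives are as close at p as their continuity allows. *)
Lemma derive_comm (R : realType) (V : normedModType R) (g : V -> R) (v w p : V) :
  (forall q, derivable g q v) -> (forall q, derivable g q w) ->
  (forall q, derivable ('D_v g) q w) -> (forall q, derivable ('D_w g) q v) ->
  {for p, continuous ('D_w ('D_v g))} -> {for p, continuous ('D_v ('D_w g))} ->
  'D_w ('D_v g) p = 'D_v ('D_w g) p.
Proof.
move=> gv gw gvw gwv cvw cwv.
apply/eqP; rewrite -subr_eq0 -normr_le0; apply/ler_addgt0Pl => e e0; rewrite addr0.
have e20 : 0 < e / 2 by rewrite divr_gt0.
move/cvgrPdist_lt: cvw => /(_ _ e20) H1.
move/cvgrPdist_lt: cwv => /(_ _ e20) H2.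
have : \forall q \near p, `|'D_w ('D_v g) p - 'D_w ('D_v g) q| < e / 2 /\
    `|'D_v ('D_w g) p - 'D_v ('D_w g) q| < e / 2.
  exact: filterI H1 H2.
move=> /nbhs_ballP[d /= d0 Hd].
(* The whole parallelogram spanned by h v and h w at p lies in the ball of
   radius d; the summand 1 keeps the denominator positive when v = w = 0. *)
pose h := d / (2 * (`|v| + `|w| + 1)).
have m0 : 0 < `|v| + `|w| + 1 by rewrite ltr_pwDr // addr_ge0.
have h0 : 0 < h by rewrite /h divr_gt0 // mulr_gt0.
have inball (s t : R) (a b : V) : 0 < s < h -> 0 < t < h ->
    `|a| + `|b| = `|v| + `|w| -> ball p d (t *: b + (s *: a + p)).
  move=> /andP[s0 sh] /andP[t0 th] ab.
  rewrite -ball_normE /=.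
  rewrite addrA opprD addrCA subrr addr0 normrN.
  apply: le_lt_trans (ler_normD _ _) _; rewrite !normrZ.
  rewrite (gtr0_norm s0) (gtr0_norm t0).
  apply: (@le_lt_trans _ _ (h * (`|v| + `|w|))).
    by rewrite -ab mulrDr addrC lerD // ler_wpM2r // ltW.
  rewrite /h; apply: (@le_lt_trans _ _ (d / 2)); last lra.
  rewrite invfM mulrA -mulrA ler_piMr ?divr_ge0 ?ltW //.
  by rewrite mulrC ltr_pdivrMr // mul1r ltrDl.
have [s [t [sh th E1]]] := mixed_difference _ _ g v w p h h0 gv gvw.
have [s' [t' [sh' th' E2]]] := mixed_difference _ _ g w v p h h0 gw gwv.
have E : 'D_w ('D_v g) (t *: w + (s *: v + p)) =
         'D_v ('D_w g) (t' *: v + (s' *: w + p)).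
  apply: (@mulfI _ (h ^+ 2)); first by rewrite gt_eqF // exprn_gt0.
  apply: etrans (esym E1) (etrans _ E2).
  by rewrite (addrCA (h *: w) (h *: v) p) (addrC (g (h *: w + p))).
have [/= B1 _] := Hd _ (inball s t v w sh th erefl).
have [/= _ B2] := Hd _ (inball s' t' w v sh' th' (addrC _ _)).
rewrite -E in B2.
have closeness (X Y Z : R) : `|Y - X| < e / 2 -> `|Z - X| < e / 2 -> `|Y - Z| <= e.
  move=> YX; rewrite distrC => XZ; rewrite [leRHS]splitr.
  exact: le_trans (ler_distD X Y Z) (ltW (ltrD YX XZ)).
exact: closeness B1 B2.
Qed.

Lemma is_derive_coord (R : realType) (V : normedModType R) (m : nat)
    (c : V -> 'rV[R]_m) (dc : 'rV[R]_m) (t v : V) (k : 'I_m) :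
  is_derive t v c dc -> is_derive t v (fun z => c z 0 k) (dc 0 k).
Proof.
move=> [dct <-]; split; first by move/derivable_mxP: dct; apply.
by rewrite derive_mx // mxE.
Qed.

Lemma is_derive_bigsum (R : realType) (V : normedModType R) (m : nat)
    (h : 'I_m -> V -> R) (dh : 'I_m -> R) (t v : V) :
  (forall k, is_derive t v (h k) (dh k)) ->
  is_derive t v (fun z => \sum_k h k z) (\sum_k dh k).
Proof.
move=> H; rewrite (_ : (fun z => _) = \sum_k h k); last by rewrite fct_sumE.
exact: is_derive_sum.
Qed.

Lemma is_derive_mulf (R : realType) (V : normedModType R) (g h : V -> R)
    (dg dh : R) (t v : V) : is_derive t v g dg -> is_derive t v h dh ->
  is_derive t v (fun z => g z * h z) (dg * h t + g t * dh).
Proof.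
move=> Hg Hh; have := @is_deriveM _ _ g h t v dg dh Hg Hh.
by congr is_derive; rewrite addrC; congr (_ + _); rewrite [LHS]mulrC.
Qed.

Lemma is_derive_mulc (R : realType) (V : normedModType R) (a : R) (g : V -> R)
    (dg : R) (t v : V) : is_derive t v g dg ->
  is_derive t v (fun z => a * g z) (a * dg).
Proof. exact: is_deriveZ. Qed.

(** Only values to the left of t are compared: in the application t may be the
    final time, where a maximum need not be critical. *)
Lemma derive_ge0_left_max (R : realType) (g : R -> R) (l t : R) :
  0 < t -> is_derive t 1 g l -> (forall s, 0 <= s <= t -> g s <= g t) -> 0 <= l.
Proof.
move=> t0 gl gmax; rewrite leNgt; apply/negP => l0.
have [/cvg_ex [l' cl]] := gl.
rewrite /derive => El.
have {}El : l' = l by rewrite -El; apply/esym/cvg_lim.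
rewrite {}El in cl.
have cl' : (fun h : R => h^-1 * (g (h + t) - g t)) @ (0 : R)^'- --> l.
  apply: (@cvg_trans _ ((fun h : R => h^-1 *: ((g \o shift t) (h *: 1) - g t)) @ (0 : R)^'-)).
    apply: near_eq_cvg; apply: nearW => h /=.
    by rewrite [h *: 1]mulr1.
  apply: cvg_trans cl; apply: cvg_app.
  by move=> A [e /= e0 Ae]; exists e => // x xe x0; apply: Ae => //; rewrite lt_eqF.
have [d /= d0 Hd] : \forall h \near (0 : R)^'-, h^-1 * (g (h + t) - g t) < 0.
  exact: cvgr_lt cl' _ l0.
pose h := Num.min (d / 2) t.
have h0 : 0 < h by rewrite lt_min t0 divr_gt0.
have hd : h < d by rewrite gt_min; apply/orP; left; lra.
have ht : h <= t by rewrite ge_min lexx orbT.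
have := Hd (- h); rewrite /= sub0r opprK gtr0_norm // => /(_ hd).
rewrite oppr_lt0 => /(_ h0).
rewrite invrN mulNr oppr_lt0 pmulr_rgt0 ?invr_gt0 // subr_gt0 ltNge gmax //.
by apply/andP; split; lra.
Qed.

(** The bound K / sqrt t on the derivative blows up at 0 but is the derivative
    of 2 K sqrt t, so g - 2 K sqrt is nonincreasing up to and including 0. *)
Lemma increment_le_sqrt (R : realType) (g dg : R -> R) (K T : R) : 0 < T ->
  {within `[0, T], continuous g} ->
  (forall t : R, 0 < t -> is_derive t 1 g (dg t)) ->
  (forall t, 0 < t -> dg t <= K / Num.sqrt t) ->
  g T - g 0 <= 2 * K * Num.sqrt T.
Proof.
move=> T0 gc gd dgK.
pose f t := g t - 2 * K * Num.sqrt t.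
have fd (t : R) : 0 < t -> is_derive t 1 f (dg t - 2 * K * (2 * Num.sqrt t)^-1).
  move=> t0; apply: is_deriveB; first exact: gd.
  by apply: is_derive_mulc; exact: is_derive1_sqrt.
have inpos (t : R) : t \in `]0, T[%R -> 0 < t by rewrite in_itv => /andP[].
have : f T <= f 0.
  apply: (@ler0_derive1_le_cc _ f 0 T) => //.
  - by move=> t /inpos t0; case: (fd t t0).
  - move=> t /inpos t0; rewrite derive1E (@derive_val _ _ _ _ _ _ _ (fd t t0)).
    rewrite subr_le0; apply: le_trans (dgK t t0) _.
    by rewrite invfM mulrA [2 * K]mulrC mulfK // lexx.
  - apply/subspace_continuousP => t tT; apply: cvgB.
      by move/subspace_continuousP: gc; apply.
    apply: cvgMl_tmp; apply: cvg_within_filter; exact: sqrt_continuous.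
  - by rewrite in_itv /= lexx ltW.
  - by rewrite in_itv /= lexx ltW.
  - exact: ltW.
rewrite /f sqrtr0; lra.
Qed.

Lemma abs_increment_le_sqrt (R : realType) (g dg : R -> R) (K T : R) : 0 <= T ->
  {within `[0, T], continuous g} ->
  (forall t : R, 0 < t -> is_derive t 1 g (dg t)) ->
  (forall t, 0 < t -> `|dg t| <= K / Num.sqrt t) ->
  `|g T - g 0| <= 2 * K * Num.sqrt T.
Proof.
rewrite le_eqVlt => /predU1P[<- _ _ _|T0 gc gd dgK].
  by rewrite subrr normr0 sqrtr0 mulr0.
rewrite ler_norml; apply/andP; split; last first.
  apply: (increment_le_sqrt _ g dg) => // t t0.
  by apply: le_trans (dgK t t0); exact: ler_norm.
rewrite lerNl opprB.
have := increment_le_sqrt _ (fun t => - g t) (fun t => - dg t) K T T0.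
rewrite opprK addrC; apply.
- by move=> t; apply: continuousN; exact: gc.
- by move=> t t0; apply: is_deriveN; exact: gd.
- by move=> t t0; apply: le_trans (dgK t t0); rewrite -normrN; exact: ler_norm.
Qed.

(** * Gram matrices and traces *)

Lemma mulmx_tr_eq0 (R : realType) (m : nat) (w : 'rV[R]_m) :
  w *m w^T = 0 -> w = 0.
Proof.
move=> /matrixP/(_ 0 0); rewrite !mxE => /eqP.
rewrite psumr_eq0 => [/allP H|i _]; last by rewrite mxE -expr2 sqr_ge0.
apply/rowP => i; have := H i (mem_index_enum i).
by rewrite !mxE /= mulf_eq0 orbb => /eqP.
Qed.

Lemma gram_unit (R : realType) (n m : nat) (J : 'M[R]_(n, m)) :
  (forall v : 'rV_n, v *m J = 0 -> v = 0) -> J *m J^T \in unitmx.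
Proof.
move=> Jinj; rewrite -row_free_unit; apply: inj_row_free => v vG.
by apply: Jinj; apply: mulmx_tr_eq0; rewrite trmx_mul mulmxA -(mulmxA v) vG mul0mx.
Qed.

(** The rows of J and the unit vector nu form a frame of the whole space, and
    J^T (J J^T)^-1 J and nu^T nu are the orthogonal projections onto the span of
    J and onto the line of nu.  In matrix terms, the two block matrices
    multiplied below are inverse to each other, in one order by computation and
    therefore in the other. *)
Lemma frame_identity (R : realType) (n : nat) (J : 'M[R]_(n, n + 1))
    (nu : 'rV[R]_(n + 1)) :
  J *m nu^T = 0 -> nu *m nu^T = 1%:M -> J *m J^T \in unitmx ->
  J^T *m invmx (J *m J^T) *m J + nu^T *m nu = 1%:M.
Proof.
move=> Jnu nunu Gu; set G := J *m J^T in Gu *.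
rewrite -mul_row_col; apply: mulmx1C.
rewrite mul_col_row mulmxA -/G mulmxV // Jnu nunu mulmxA.
by rewrite -[nu *m J^T]trmxK trmx_mul trmxK Jnu trmx0 mul0mx -scalar_mx_block.
Qed.

(** This square-root-like factorization replaces a diagonalization of the
    metric: conjugating by K turns traces of invmx (J J^T) F into traces of the
    congruent matrix K^T F K, which keeps sign and symmetry. *)
Lemma invmx_gram (R : realType) (n m : nat) (J : 'M[R]_(n, m)) :
  J *m J^T \in unitmx ->
  exists K : 'M[R]_(n, m), invmx (J *m J^T) = K *m K^T.
Proof.
set G := J *m J^T => Gu; exists (invmx G *m J).
by rewrite trmx_mul trmx_inv [G^T]trmx_mul trmxK -/G mulmxA -(mulmxA _ J) -/G mulVmx // mul1mx.
Qed.

Lemma mxtrace_nonpos (R : realType) (n m : nat) (J : 'M[R]_(n, m)) (F : 'M[R]_n) :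
  J *m J^T \in unitmx ->
  (forall v : 'rV_n, (v *m F *m v^T) 0 0 <= 0) ->
  \tr (invmx (J *m J^T) *m F) <= 0.
Proof.
move=> /invmx_gram[K ->] Fneg.
rewrite -mulmxA mxtrace_mulC; apply: sumr_le0 => k _.
suff -> : (K^T *m F *m K) k k = (row k K^T *m F *m (row k K^T)^T) 0 0 by [].
rewrite tr_row trmxK -row_mul !mxE.
by apply: eq_bigr => j _; rewrite !mxE.
Qed.

(** Cauchy-Schwarz, as the nonnegativity of the variance of a. *)
Lemma sqr_sum_le (R : realType) (m : nat) (a : 'I_m -> R) :
  (\sum_i a i) ^+ 2 <= m%:R * \sum_i a i ^+ 2.
Proof.
case: m a => [|m] a; first by rewrite !big_ord0 expr0n mul0r.
set S := \sum_i a i; set Q := \sum_i a i ^+ 2; set M : R := m.+1%:R.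
have M0 : 0 < M by rewrite ltr0n.
have : 0 <= \sum_i (M * a i - S) ^+ 2 by apply: sumr_ge0 => i _; rewrite sqr_ge0.
have -> : \sum_i (M * a i - S) ^+ 2 = M * (M * Q - S ^+ 2).
  under eq_bigr do rewrite sqrrB exprMn.
  rewrite big_split sumrB /= -mulr_sumr -/Q sumr_const card_ord -mulr_natl -/M.
  rewrite (eq_bigr (fun i => (2 * M * S) * a i)) => [|i _]; last by ring.
  by rewrite -mulr_sumr -/S; ring.
by rewrite pmulr_rge0 // subr_ge0.
Qed.

(** With W = K^T h K symmetric, the right side is m times the sum of the squares
    of all entries of W, of which the diagonal ones suffice.  The factor is the
    ambient dimension m because W is an m x m matrix. *)
Lemma sqr_mxtrace_le (R : realType) (n m : nat) (J : 'M[R]_(n, m)) (h : 'M[R]_n) :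
  J *m J^T \in unitmx -> h^T = h ->
  \tr (invmx (J *m J^T) *m h) ^+ 2 <=
  m%:R * \tr (invmx (J *m J^T) *m h *m (invmx (J *m J^T) *m h)).
Proof.
move=> /invmx_gram[K ->] hs; pose W := K^T *m h *m K.
have Ws : W^T = W by rewrite /W !trmx_mul trmxK hs mulmxA.
have -> : \tr (K *m K^T *m h) = \tr W by rewrite -mulmxA mxtrace_mulC.
have -> : \tr (K *m K^T *m h *m (K *m K^T *m h)) = \tr (W *m W).
  by rewrite /W -!mulmxA mxtrace_mulC !mulmxA.
clearbody W; apply: le_trans (sqr_sum_le _ _ _) _; rewrite ler_wpM2l ?ler0n //.
apply: ler_sum => i _; rewrite [leRHS]mxE (bigD1 i) //= -expr2 lerDl.
by apply: sumr_ge0 => j _; rewrite -{2}Ws mxE -expr2 sqr_ge0.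
Qed.

(** * Euclidean norm *)

Lemma enorm_sqr (R : realType) (n : nat) (y : 'rV[R]_n) : enorm y ^+ 2 = \sum_i y 0 i ^+ 2.
Proof.
rewrite sqr_sqrtr; last by apply: sumr_ge0 => k _; rewrite -expr2 sqr_ge0.
by apply: eq_bigr => i _; rewrite expr2.
Qed.

Lemma enorm_ge0 (R : realType) (n : nat) (y : 'rV[R]_n) : 0 <= enorm y.
Proof. exact: sqrtr_ge0. Qed.

Lemma coord_le_enorm (R : realType) (n : nat) (y : 'rV[R]_n) i : `|y 0 i| <= enorm y.
Proof.
rewrite -sqrtr_sqr ler_wsqrtr // /dot (bigD1 i) //= -expr2 lerDl.
by apply: sumr_ge0 => j _; rewrite -expr2 sqr_ge0.
Qed.

(** * Immersed hypersurfaces *)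

Section Immersion.
Context {R : realType} {n : nat}.
Implicit Types (f nu : 'rV[R]_n -> 'rV[R]_(n + 1)) (p v w : 'rV[R]_n).

Definition jac_mx f p : 'M[R]_(n, n + 1) := \matrix_(i, k) partial f i p 0 k.

Lemma first_formE f p : first_form f p = jac_mx f p *m (jac_mx f p)^T.
Proof.
by apply/matrixP => i j; rewrite !mxE; apply: eq_bigr => k _; rewrite !mxE.
Qed.

Lemma derive_jac f p v : differentiable f p -> 'D_v f p = v *m jac_mx f p.
Proof.
move=> df; rewrite deriveE // {1}[v]row_sum_delta linear_sum.
apply/rowP => k; rewrite summxE mxE; apply: eq_bigr => i _.
by rewrite linearZ /= !mxE /partial deriveE.
Qed.

Lemma smooth_differentiable f (vs : seq 'rV[R]_n) p :
  smooth_on setT f -> differentiable (foldr (fun v g => 'D_v g) f vs) p.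
Proof. by move=> fs; apply: fs. Qed.

Lemma smooth_derive_comm f v w p : smooth_on setT f ->
  'D_w ('D_v f) p = 'D_v ('D_w f) p.
Proof.
move=> fs.
have d0 q : differentiable f q := smooth_differentiable f [::] q fs.
have d1 a q : differentiable ('D_a f) q := smooth_differentiable f [:: a] q fs.
have d2 a b q : differentiable ('D_a ('D_b f)) q :=
  smooth_differentiable f [:: a; b] q fs.
apply/rowP => k; pose g q := f q 0 k.
have g1 a q : is_derive q a g ('D_a f q 0 k).
  apply: (is_derive_coord _ _ _ f); apply: derivableP; exact: diff_derivable.
have Eg1 a : 'D_a g = fun q => 'D_a f q 0 k.
  by rewrite funeqE => q; exact: (@derive_val _ _ _ _ _ _ _ (g1 a q)).
have g2 a b q : is_derive q a ('D_b g) ('D_a ('D_b f) q 0 k).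
  rewrite Eg1; apply: (is_derive_coord _ _ _ ('D_b f)); apply: derivableP.
  exact: diff_derivable.
have Eg2 a b : 'D_a ('D_b g) = fun q => 'D_a ('D_b f) q 0 k.
  by rewrite funeqE => q; exact: (@derive_val _ _ _ _ _ _ _ (g2 a b q)).
have cont a b : {for p, continuous ('D_a ('D_b g))}.
  rewrite Eg2; apply: differentiable_continuous.
  apply: (@differentiable_comp _ _ _ _ ('D_a ('D_b f))
    (fun M : 'rV_(n + 1) => M 0 k)) => //.
  exact: differentiable_coord.
apply: etrans (esym (@derive_val _ _ _ _ _ _ _ (g2 w v p))) _.
apply: etrans _ (@derive_val _ _ _ _ _ _ _ (g2 v w p)).
apply: derive_comm => // q; first [by case: (g1 v q) | by case: (g1 w q)
  | by case: (g2 w v q) | by case: (g2 v w q)].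
Qed.

(** The second derivative along a line is the Hessian quadratic form; this is
    how a maximum along every line is turned into a matrix inequality. *)
Lemma second_derivative_quadratic f v p k : smooth_on setT f ->
  'D_v ('D_v f) p 0 k =
  \sum_j (\sum_i v 0 i * partial (partial f j) i p 0 k) * v 0 j.
Proof.
move=> fs; rewrite derive_jac; last exact: (smooth_differentiable f [:: v] p).
rewrite mxE; apply: eq_bigr => j _; rewrite mulrC mxE; congr (_ * _).
rewrite /partial smooth_derive_comm // derive_jac.
  by rewrite mxE; apply: eq_bigr => i _; rewrite mxE.
exact: (smooth_differentiable f [:: delta_mx 0 j] p).
Qed.

Lemma second_form_sym f nu p : smooth_on setT f ->
  (second_form f nu p)^T = second_form f nu p.
Proof.
by move=> fs; apply/matrixP => i j; rewrite !mxE /partial smooth_derive_comm.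
Qed.

(** The rows of the Jacobian are independent because the differential is
    injective, so the metric is invertible and invmx is a true inverse. *)
Lemma first_form_unit f p : immersion f ->
  jac_mx f p *m (jac_mx f p)^T \in unitmx.
Proof.
move=> [fs finj]; apply: gram_unit => v vJ.
have df : differentiable f p := smooth_differentiable f [::] p fs.
by apply: (finj p); rewrite -deriveE // derive_jac // vJ linear0.
Qed.

(** The sharp constant is n; n + 1 comes for free from [sqr_mxtrace_le] and is as
    good for displacement estimates. *)
Lemma sqr_mean_curvature_le f nu p : immersion f ->
  mean_curvature f nu p ^+ 2 <= (n + 1)%:R * sqnormA f nu p.
Proof.
move=> fi; have [fs _] := fi.
rewrite /sqnormA /mean_curvature /shape_operator first_formE.
by apply: sqr_mxtrace_le; [exact: first_form_unit | exact: second_form_sym].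
Qed.

End Immersion.

Section SpatialMaximum.
Context {R : realType} {n : nat}.

(** Let Q be the diagonal quadratic form with weights q.  At a maximum of Q on
    the hypersurface the gradient 2 q f is normal, say 2 lam nu, and the Laplacian
    of Q is 2 (tr Q on the tangent space) - 2 lam H <= 0.  The left side below is
    that tangential trace, computed as the full trace minus Q (nu). *)
Lemma mean_curvature_at_max (f nu : 'rV[R]_n -> 'rV[R]_(n + 1)) (p : 'rV[R]_n)
    (q : 'I_(n + 1) -> R) :
  immersion f -> enorm (nu p) = 1 ->
  (forall i, dot (nu p) (partial f i p) = 0) ->
  (forall p', \sum_k q k * f p' 0 k ^+ 2 <= \sum_k q k * f p 0 k ^+ 2) ->
  \sum_k q k * (1 - nu p 0 k ^+ 2) <=
  (\sum_k q k * f p 0 k * nu p 0 k) * mean_curvature f nu p.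
Proof.
move=> fi nu1 nuT fmax; have [fs _] := fi.
have d0 x : differentiable f x := smooth_differentiable f [::] x fs.
have d1 a x : differentiable ('D_a f) x := smooth_differentiable f [:: a] x fs.
pose J := jac_mx f p; pose G := J *m J^T.
have Gu : G \in unitmx by exact: first_form_unit.
pose h := second_form f nu p.
pose qf : 'rV[R]_(n + 1) := \row_k (q k * f p 0 k).
pose D : 'M[R]_(n + 1) := diag_mx (\row_k q k).
(* First and second derivative tests along the line through p in direction v. *)
have along v : 'D_v f p *m qf^T = 0 /\
    \sum_k q k * ('D_v f p 0 k ^+ 2 + f p 0 k * 'D_v ('D_v f) p 0 k) <= 0.
  pose c (s : R) := f (s *: v + p); pose dc (s : R) := 'D_v f (s *: v + p).
  have cP (s : R) k : is_derive s 1 (fun s => c s 0 k) (dc s 0 k).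
    by apply: is_derive_coord; apply: is_derive_line; apply: diff_derivable.
  have dcP k : is_derive (0 : R) 1 (fun s => dc s 0 k) ('D_v ('D_v f) p 0 k).
    have -> : 'D_v ('D_v f) p = 'D_v ('D_v f) (0 *: v + p) by rewrite scale0r add0r.
    apply: is_derive_coord; apply: is_derive_line.
    exact: diff_derivable.
  pose phi (s : R) := \sum_k q k * (c s 0 k * c s 0 k).
  pose dphi (s : R) := \sum_k q k * (dc s 0 k * c s 0 k + c s 0 k * dc s 0 k).
  have phiP (s : R) : is_derive s 1 phi (dphi s).
    apply: is_derive_bigsum => k; apply: is_derive_mulc.
    by apply: (is_derive_mulf _ _ (fun s => c s 0 k) (fun s => c s 0 k)).
  have c0 : c 0 = f p by rewrite /c scale0r add0r.
  have dc0 : dc 0 = 'D_v f p by rewrite /dc scale0r add0r.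
  pose l := \sum_k q k * (('D_v ('D_v f) p 0 k * c 0 0 k + dc 0 0 k * dc 0 0 k) +
                          (dc 0 0 k * dc 0 0 k + c 0 0 k * 'D_v ('D_v f) p 0 k)).
  have dphiP : is_derive (0 : R) 1 dphi l.
    apply: is_derive_bigsum => k; apply: is_derive_mulc.
    apply: is_deriveD.
      by apply: (is_derive_mulf _ _ (fun s => dc s 0 k) (fun s => c s 0 k)).
    by apply: (is_derive_mulf _ _ (fun s => c s 0 k) (fun s => dc s 0 k)).
  have phimax (s : R) : phi s <= phi 0 by rewrite /phi c0; exact: fmax.
  have [E1 E2] := second_derivative_at_max _ _ _ _ phiP dphiP phimax.
  split.
    apply/matrixP => i j; rewrite !ord1 !mxE.
    apply: (@mulfI _ (2 : R)); first by rewrite pnatr_eq0.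
    rewrite mulr0 -[RHS]E1 /dphi c0 dc0 mulr_sumr; apply: eq_bigr => k _.
    by rewrite !mxE; ring.
  rewrite -(pmulr_rle0 _ (ltr0Sn R 1)) mulr_sumr; apply: le_trans E2.
  rewrite /l c0 dc0; apply: ler_sum => k _.
  by rewrite le_eqVlt; apply/orP; left; apply/eqP; ring.
have nunu : nu p *m (nu p)^T = 1%:M.
  apply/matrixP => i j; rewrite !ord1 !mxE eqxx /=.
  have : dot (nu p) (nu p) = 1.
    have := sqr_sqrtr (_ : 0 <= dot (nu p) (nu p)); rewrite -/(enorm _) nu1 expr1n.
    by move=> <- //; apply: sumr_ge0 => k _; rewrite -expr2 sqr_ge0.
  by move=> <-; apply: eq_bigr => k _; rewrite mxE.
have Jnu : J *m (nu p)^T = 0.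
  apply/matrixP => i j; rewrite !ord1 !mxE -[RHS](nuT i).
  by apply: eq_bigr => k _; rewrite !mxE mulrC.
have Jqf : J *m qf^T = 0.
  apply/matrixP => i j; have [/matrixP/(_ 0 j) + _] := along (delta_mx 0 i).
  rewrite !mxE => E; rewrite -[RHS]E.
  by apply: eq_bigr => k _; rewrite !mxE.
have frame := frame_identity _ _ J (nu p) Jnu nunu Gu.
pose lam := \sum_k q k * f p 0 k * nu p 0 k.
(* q f is orthogonal to all tangent vectors, hence a multiple of the normal. *)
have qfE : qf = lam *: nu p.
  rewrite -[LHS]mulmx1 -frame mulmxDr !mulmxA -[qf *m J^T]trmxK trmx_mul trmxK.
  rewrite Jqf trmx0 !mul0mx add0r [qf *m _]mx11_scalar mul_scalar_mx; congr (_ *: _).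
  by rewrite !mxE; apply: eq_bigr => k _; rewrite !mxE.
(* F is half the Hessian of Q along the immersion; its part containing second
   derivatives of f is - lam h because q f = lam nu. *)
pose F := J *m D *m J^T - lam *: h.
have Fneg (v : 'rV[R]_n) : (v *m F *m v^T) 0 0 <= 0.
  have [_] := along v; apply: le_trans; rewrite le_eqVlt; apply/orP; left.
  apply/eqP.
  have -> : v *m F *m v^T = 'D_v f p *m D *m ('D_v f p)^T - lam *: (v *m h *m v^T).
    rewrite /F mulmxBr mulmxBl -scalemxAr -scalemxAl derive_jac // -/J.
    by rewrite trmx_mul !mulmxA.
  rewrite mxE [X in _ + X]mxE.
  have -> : ('D_v f p *m D *m ('D_v f p)^T) 0 0 = \sum_k q k * 'D_v f p 0 k ^+ 2.
    rewrite mul_mx_diag mxE; apply: eq_bigr => k _; rewrite !mxE; ring.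
  have -> : (lam *: (v *m h *m v^T)) 0 0 =
            - \sum_k q k * (f p 0 k * 'D_v ('D_v f) p 0 k).
    have E k : q k * f p 0 k = lam * nu p 0 k.
      by have /rowP/(_ k) := qfE; rewrite !mxE.
    rewrite mxE [X in lam * X]mxE mulr_sumr.
    under [in RHS]eq_bigr => k _ do
      rewrite mulrA E (second_derivative_quadratic _ _ _ _ fs) mulr_sumr.
    rewrite exchange_big -sumrN; apply: eq_bigr => j _.
    rewrite !mxE mulr_suml mulr_sumr.
    under [in RHS]eq_bigr => k _ do rewrite mulr_suml mulr_sumr.
    rewrite exchange_big -sumrN; apply: eq_bigr => i _.
    rewrite !mxE /dot mulrN !mulNr mulrN mulr_sumr mulr_suml mulr_sumr; congr (- _).
    by apply: eq_bigr => k _; ring.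
  by rewrite opprK -big_split; apply: eq_bigr => k _; rewrite mulrDr.
have trD : \tr (invmx G *m (J *m D *m J^T)) = \sum_k q k * (1 - nu p 0 k ^+ 2).
  rewrite mulmxA mxtrace_mulC !mulmxA.
  have -> : J^T *m invmx G *m J = 1%:M - (nu p)^T *m nu p by rewrite -frame addrK.
  apply: eq_bigr => k _; rewrite mul_mx_diag !mxE eqxx big_ord1 !mxE -expr2.
  exact: mulrC.
have := mxtrace_nonpos _ _ _ J F Gu Fneg.
rewrite /F mulmxBr raddfB /= trD -scalemxAr mxtraceZ subr_le0.
by rewrite /mean_curvature /shape_operator first_formE.
Qed.

End SpatialMaximum.

(** * The quadratic form of the barrier *)

Section Cone.
Context {R : realType} {n : nat}.
Implicit Types (a : R) (X Y : 'rV[R]_(n + 1)).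

Definition cone_weight a (k : 'I_(n + 1)) : R := if (k < n)%N then 1 else - a.

(** The quadratic form |y|^2 - a z^2 for X = (y, z) in R^n x R. *)
Definition cone_form a X : R := \sum_k cone_weight a k * X 0 k ^+ 2.

Lemma cone_weight_sum a (X : 'I_(n + 1) -> R) :
  \sum_k cone_weight a k * X k = \sum_(i < n) X (lshift 1 i) - a * X (rshift n 0).
Proof.
rewrite big_split_ord /= big_ord1; congr (_ + _).
  by apply: eq_bigr => i _; rewrite /cone_weight /= ltn_ord mul1r.
by rewrite /cone_weight /= addn0 ltnn mulNr.
Qed.

(** The sum equals n - 1 - a + (1 + a) nu_z^2; this is where n >= 2 enters: a
    hypersurface has enough horizontal tangent directions. *)
Lemma cone_form_tangential a (nu : 'rV[R]_(n + 1)) : (2 <= n)%N ->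
  0 <= a <= 2^-1 -> enorm nu = 1 ->
  2^-1 <= \sum_k cone_weight a k * (1 - nu 0 k ^+ 2).
Proof.
move=> n2 /andP[a0 a1] nu1.
have n2' : (2 : R) <= n%:R by rewrite ler_nat.
have nunu : \sum_k nu 0 k ^+ 2 = 1.
  have : 0 <= dot nu nu by apply: sumr_ge0 => k _; rewrite -expr2 sqr_ge0.
  move=> /sqr_sqrtr; rewrite -/(enorm nu) nu1 expr1n => ->.
  by apply: eq_bigr => k _; rewrite expr2.
rewrite cone_weight_sum sumrB sumr_const card_ord.
move: nunu; rewrite big_split_ord /= big_ord1.
set s := \sum_(i < n) _; set z := nu 0 (rshift n 0) => E.
have z0 : 0 <= z ^+ 2 := sqr_ge0 _.
have az : 0 <= a * z ^+ 2 by rewrite mulr_ge0.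
rewrite -[1 *+ n]/(n%:R); lra.
Qed.

Lemma cone_form_graph a (y : 'rV[R]_n) (z : R) :
  cone_form a (row_mx y z%:M) = enorm y ^+ 2 - a * z ^+ 2.
Proof.
rewrite /cone_form cone_weight_sum row_mxEr mxE eqxx enorm_sqr; congr (_ - _).
by apply: eq_bigr => i _; rewrite row_mxEl.
Qed.

(** Young's inequalities |y'|^2 <= 2 |y|^2 + 2 n d^2 and z'^2 >= z^2 / 2 - d^2. *)
Lemma cone_form_shift_le a X Y (d : R) : 0 <= a ->
  (forall k, `|Y 0 k - X 0 k| <= d) ->
  cone_form a Y <=
  2 * (\sum_(i < n) X 0 (lshift 1 i) ^+ 2) - a / 2 * X 0 (rshift n 0) ^+ 2
  + (2 * n%:R + a) * d ^+ 2.
Proof.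
move=> a0 XY.
have XY2 k : (Y 0 k - X 0 k) ^+ 2 <= d ^+ 2.
  by rewrite -(real_normK (num_real (_ - _))) lerXn2r ?nnegrE ?(le_trans _ (XY k)).
rewrite /cone_form cone_weight_sum.
have sumY : \sum_(i < n) Y 0 (lshift 1 i) ^+ 2 <=
    2 * (\sum_(i < n) X 0 (lshift 1 i) ^+ 2) + 2 * n%:R * d ^+ 2.
  have -> : 2 * n%:R * d ^+ 2 = \sum_(i < n) 2 * d ^+ 2.
    by rewrite sumr_const card_ord -mulr_natl; ring.
  rewrite mulr_sumr -big_split /=; apply: ler_sum => i _.
  have := XY2 (lshift 1 i); set u := X 0 _; set v := Y 0 _.
  have := sqr_ge0 (v - 2 * u); rewrite !expr2; nra.
have zY : X 0 (rshift n 0) ^+ 2 / 2 - d ^+ 2 <= Y 0 (rshift n 0) ^+ 2.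
  have := XY2 (rshift n 0); set u := X 0 _; set v := Y 0 _.
  have := sqr_ge0 (2 * v - u); rewrite !expr2; nra.
have := ler_wpM2l a0 zY; lra.
Qed.

Lemma cone_form_height_ge a X : 0 <= a -> - a * X 0 (rshift n 0) ^+ 2 <= cone_form a X.
Proof.
move=> a0; rewrite /cone_form cone_weight_sum mulNr lerDr.
by apply: sumr_ge0 => i _; rewrite sqr_ge0.
Qed.

End Cone.

Lemma continuous_cone_form (R : realType) (n : nat) (a : R) :
  continuous (@cone_form R n a).
Proof.
move=> X; apply: differentiable_continuous; rewrite /cone_form.
rewrite (_ : (fun X => _) = \sum_k (fun X : 'rV[R]_(n+1) => cone_weight a k * X 0 k ^+ 2)); last first.
  by apply/funext => Y; rewrite fct_sumE.
apply: differentiable_sum => k; apply: differentiableM => //.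
by apply: differentiableM; exact: differentiable_coord.
Qed.

(** * Mean curvature flow *)

Section Flow.
Context {R : realType} {n : nat}.
Implicit Types (x nu : R -> 'rV[R]_n -> 'rV[R]_(n + 1)) (p : 'rV[R]_n).

Lemma is_derive_mcf x nu (t : R) p k : longtime_mcf x nu -> 0 < t ->
  is_derive t 1 (fun s => x s p 0 k)
    (- (mean_curvature (x t) (nu t) p * nu t p 0 k)).
Proof.
move=> x_mcf t0.
have xd : differentiable (fun z : R * 'rV[R]_n => x z.1 z.2) (t, p).
  exact: (mcf_smooth x_mcf [::]).
have td : derivable (fun s => x s p) t 1.
  apply/derivable1_diffP.
  apply: (@differentiable_comp _ _ _ _ (fun s : R => (s, p))
    (fun z : R * 'rV[R]_n => x z.1 z.2)) => //.
have -> : - (mean_curvature (x t) (nu t) p * nu t p 0 k) =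
    (- (mean_curvature (x t) (nu t) p *: nu t p)) 0 k by rewrite !mxE.
apply: is_derive_coord; split => //.
by rewrite -derive1E (mcf_eq x_mcf).
Qed.

Lemma mcf_continuous_time x nu p k T : longtime_mcf x nu ->
  {within `[0, T], continuous (fun s => x s p 0 k)}.
Proof.
move=> x_mcf; apply/subspace_continuousP => s; rewrite /= in_itv /= => /andP[s0 sT].
have /subspace_continuousP/(_ (s, p) s0) xc := mcf_continuous x_mcf.
apply: (@cvg_comp _ _ _ (fun s => x s p) (fun M : 'rV_(n+1) => M 0 k)) ; last first.
  exact: coord_continuous.
apply: (@cvg_comp _ _ _ (fun s => (s, p)) (fun z : R * 'rV[R]_n => x z.1 z.2)) xc.
move=> A wA; have c : (fun s' : R => (s', p)) @ s --> (s, p).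
  exact: (@differentiable_continuous _ _ _ s (fun s' : R => (s', p))).
have near_s : nbhs s (fun s' : R => 0 <= s' -> A (s', p)) := c _ wA.
suff : nbhs s (fun s' : R => s' \in `[0, T]%R -> A (s', p)) by [].
by apply: filterS near_s => s' As'; rewrite in_itv /= => /andP[/As'].
Qed.

(** The velocity is - H nu with |H| <= sqrt ((n + 1) C / t), which is integrable
    at t = 0: starting from the initial hypersurface no point travels further
    than a multiple of sqrt t. *)
Lemma displacement_le x nu (C : R) : longtime_mcf x nu ->
  (forall (t : R) p, 0 < t -> t * sqnormA (x t) (nu t) p <= C) ->
  forall (t : R) p k, 0 <= t ->
  `|x t p 0 k - x 0 p 0 k| <= 2 * Num.sqrt ((n + 1)%:R * C) * Num.sqrt t.
Proof.
move=> x_mcf AC t p k t0.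
apply: (abs_increment_le_sqrt _ (fun s => x s p 0 k)
  (fun s => - (mean_curvature (x s) (nu s) p * nu s p 0 k))) => //.
- exact: mcf_continuous_time x_mcf.
- by move=> s s0; exact: is_derive_mcf.
move=> s s0; rewrite normrN normrM.
have [xi _] := mcf_complete x_mcf (ltW s0).
have [nu1 _] := mcf_normal x_mcf s0 p.
apply: (@le_trans _ _ `|mean_curvature (x s) (nu s) p|).
  by rewrite ler_piMr // -nu1; exact: coord_le_enorm.
rewrite -sqrtr_sqr ler_pdivlMr ?sqrtr_gt0 // -sqrtrM ?sqr_ge0 // ler_wsqrtr //.
apply: (@le_trans _ _ ((n + 1)%:R * sqnormA (x s) (nu s) p * s)).
  by apply: ler_wpM2r (ltW s0) _ _ _; exact: sqr_mean_curvature_le.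
by rewrite -mulrA ler_wpM2l ?ler0n // mulrC AC.
Qed.

(** At such a maximum the derivative of the barrier in time is
    1/2 - 2 lam H <= 1/2 - 1 < 0, so the barrier was larger a moment before. *)
Lemma barrier_no_late_max x nu (a t : R) p :
  longtime_mcf x nu -> (2 <= n)%N -> 0 <= a <= 2^-1 -> 0 < t ->
  ~ (forall (s : R) p', 0 <= s <= t ->
     cone_form a (x s p') + s / 2 <= cone_form a (x t p) + t / 2).
Proof.
move=> x_mcf n2 a01 t0 Phimax.
have [xi _] := mcf_complete x_mcf (ltW t0).
have [nu1 nuT] := mcf_normal x_mcf t0 p.
pose lam := \sum_k cone_weight a k * x t p 0 k * nu t p 0 k.
pose H := mean_curvature (x t) (nu t) p.
have lamH : 2^-1 <= lam * H.
  apply: le_trans (cone_form_tangential a (nu t p) n2 a01 nu1) _.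
  apply: mean_curvature_at_max => // p'.
  by have := Phimax t p'; rewrite lexx ltW // lerD2r => /(_ isT).
have dPhi : is_derive t 1 (fun s : R => cone_form a (x s p) + 2^-1 * s)
    (\sum_k cone_weight a k * (- (H * nu t p 0 k) * x t p 0 k +
                               x t p 0 k * - (H * nu t p 0 k)) + 2^-1 * 1).
  have d2 : is_derive t 1 (fun s : R => 2^-1 * s) (2^-1 * 1).
    exact: (is_derive_mulc R R 2^-1 id 1 t 1 (is_derive_id _ _)).
  apply: is_deriveD.
  apply: is_derive_bigsum => k; apply: is_derive_mulc.
  have dx := is_derive_mcf x nu t p k x_mcf t0.
  exact: (is_derive_mulf _ _ (fun s => x s p 0 k) (fun s => x s p 0 k)).
have noninc (s : R) : 0 <= s <= t ->
    cone_form a (x s p) + 2^-1 * s <= cone_form a (x t p) + 2^-1 * t.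
  by rewrite ![2^-1 * _]mulrC; exact: Phimax.
have := derive_ge0_left_max _ _ _ _ t0 dPhi noninc.
have -> : \sum_k cone_weight a k * (- (H * nu t p 0 k) * x t p 0 k +
                               x t p 0 k * - (H * nu t p 0 k)) = - 2 * (lam * H).
  by rewrite mulr_suml mulr_sumr; apply: eq_bigr => k _; ring.
rewrite mulr1; lra.
Qed.

(** Outside the compact set K the barrier is at most B, so if it exceeds B
    anywhere, then its maximum over [0, T] x K is a maximum over all of space, at
    a positive time, which [barrier_no_late_max] forbids. *)
Lemma barrier_le x nu (a T B : R) (K : set 'rV[R]_n) :
  longtime_mcf x nu -> (2 <= n)%N -> 0 <= a <= 2^-1 -> 0 <= T -> compact K ->
  (forall (t : R) p, 0 <= t <= T -> ~ K p -> cone_form a (x t p) + t / 2 <= B) ->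
  (forall p, cone_form a (x 0 p) <= B) ->
  forall p, cone_form a (x T p) + T / 2 <= B.
Proof.
move=> x_mcf n2 a01 T0 K_compact far initial p0.
pose Phi (z : R * 'rV[R]_n) := cone_form a (x z.1 z.2) + z.1 / 2.
rewrite leNgt; apply/negP => late.
have TT : 0 <= T <= T by rewrite T0 lexx.
have Kp0 : K p0.
  by apply: contrapT => nKp0; have := far T p0 TT nKp0; rewrite leNgt late.
have Phi_cont : {within `[0, T]%classic `*` K, continuous Phi}.
  apply/subspace_continuousP => -[t p] [/=]; rewrite in_itv /= => /andP[t0 tT] Kp.
  apply: cvgD.
    have /subspace_continuousP/(_ (t, p) t0) xc := mcf_continuous x_mcf.
    apply: (@cvg_comp _ _ _ (fun z : R * 'rV[R]_n => x z.1 z.2) (cone_form a)); last first.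
      exact: continuous_cone_form.
    move=> A xA.
    have near_z : nbhs (t, p) (fun z : R * 'rV[R]_n => 0 <= z.1 -> A (x z.1 z.2)).
      exact: xc _ xA.
    suff : nbhs (t, p) (fun z : R * 'rV[R]_n =>
      (`[0, T]%classic `*` K) z -> A (x z.1 z.2)) by [].
    apply: filterS near_z => z Az [/= + _].
    by rewrite in_itv /= => /andP[z0 _]; exact: Az.
  apply: cvgMr_tmp; apply: cvg_within_filter; exact: cvg_fst.
have TK_compact : compact (`[0, T]%classic `*` K).
  exact: (compact_setX (@segment_compact R 0 T) K_compact).
have TK0 : (`[0, T]%classic `*` K) !=set0.
  by exists (T, p0); split; rewrite //= in_itv.
have [[t p] + pmax] := compact_EVT_max TK0 TK_compact Phi_cont.
rewrite inE => -[/=]; rewrite in_itv /= => /andP[t0 tT] Kp.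
have Phi_late : B < Phi (t, p).
  apply: lt_le_trans late (pmax (T, p0) _); rewrite inE.
  by split; rewrite //= in_itv.
have t_gt0 : 0 < t.
  rewrite lt_neqAle t0 andbT; apply/eqP => t00.
  by have := initial p; move: Phi_late; rewrite -t00 /Phi /= mul0r addr0 ltNge => /negP.
apply: (barrier_no_late_max x nu a t p x_mcf n2 a01 t_gt0) => s p' /andP[s0 st].
have sT : 0 <= s <= T by rewrite s0 (le_trans st).
have [Kp'|nKp'] := pselect (K p'); last first.
  exact/(le_trans (far s p' sT nKp'))/ltW.
by apply: (pmax (s, p')); rewrite inE; split; rewrite //= in_itv.
Qed.

End Flow.

Lemma curvature_bound_not_typeIIb (R : realType) (n : nat)
    (x nu : R -> 'rV[R]_n -> 'rV[R]_(n + 1)) :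
  ~ typeIIb x nu ->
  exists C : R, forall t p, 0 < t -> t * sqnormA (x t) (nu t) p <= C.
Proof.
rewrite /typeIIb; set S := (X in ereal_sup X) => supS.
have ubS (t : R) p : 0 < t -> ((t * sqnormA (x t) (nu t) p)%:E <= ereal_sup S)%E.
  by move=> t0; apply: ereal_sup_ubound; exists (t, p).
case E : (ereal_sup S) supS ubS => [r| |] // _ ubS; [exists r | exists 0] => t p t0.
  by have := ubS t p t0; rewrite lee_fin.
by have := ubS t p t0; rewrite leeNy_eq.
Qed.

(** * The initial graph *)

Lemma cvg_mx_entries (R : realType) (T : Type) (F : set_system T) (FF : Filter F)
    (m k : nat) (f : T -> 'M[R]_(m, k)) (l : 'M[R]_(m, k)) :
  (forall i j, (fun z => f z i j) @ F --> l i j) -> f @ F --> l.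
Proof.
move=> fl; apply/cvgrPdist_le => /= e e0; near=> z.
rewrite /Num.Def.normr/= mx_normrE (bigmax_le _ (ltW e0))//= => i _.
rewrite !mxE /=.
move: i; near: z; apply: filter_forall => /= i.
exact: ((cvgrPdist_le _ _).1 (fl i.1 i.2)).
Unshelve. all: by end_near. Qed.

Lemma continuous_graph_map (R : realType) (n : nat) (U : 'rV[R]_n -> R) :
  continuous U -> continuous (fun y => row_mx y (U y)%:M : 'rV[R]_(n + 1)).
Proof.
move=> Uc y; apply: (@cvg_mx_entries _ _ (nbhs y) (nbhs_filter y)) => i j; rewrite ord1.
case: (split_ordP j) => k ->.
  rewrite row_mxEl; under eq_fun do rewrite row_mxEl.
  exact: coord_continuous.
rewrite row_mxEr mxE ord1; under eq_fun do rewrite row_mxEr mxE.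
exact: Uc.
Qed.

(** An embedding onto an entire graph is proper: its left inverse is continuous,
    so the parameters of the points over a large closed cube, which contains the
    Euclidean ball of radius rho, form a compact set. *)
Lemma far_outside_compact (R : realType) (n : nat) (U : 'rV[R]_n -> R)
    (f : 'rV[R]_n -> 'rV[R]_(n + 1)) (rho : R) :
  continuous U -> embedding f -> range f = entire_graph U ->
  exists2 K : set 'rV[R]_n, compact K & forall p, ~ K p ->
    exists2 y, f p = row_mx y (U y)%:M & rho < enorm y.
Proof.
move=> Uc [_ [g gK gc]] fU.
pose phi y : 'rV[R]_(n + 1) := row_mx y (U y)%:M.
pose B := [set v : 'rV[R]_n | forall i, `[- rho, rho]%classic (v ord0 i)].
exists (g @` (phi @` B)).
  apply: continuous_compact.
    apply: continuous_subspaceW gc => _ [y _ <-]; rewrite fU; by exists y.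
  apply: continuous_compact; last first.
    exact: (rV_compact (fun i => @segment_compact R (- rho) rho)).
  apply: continuous_subspaceT; exact: continuous_graph_map.
move=> p nKp; have : range f (f p) by exists p.
rewrite fU => -[y _ fy]; exists y => //.
rewrite ltNge; apply/negP => yrho; apply: nKp.
exists (f p); last exact: gK.
exists y => // i; rewrite /= in_itv /= -ler_norml.
exact: le_trans (coord_le_enorm _ _ _ _) yrho.
Qed.

(** Since r^eps tends to infinity, u' exceeds |M| + 1 from some r_0 on, and
    integrating from r_0 leaves a surplus of slope 1 over M r that absorbs the
    constant M r_0 - u r_0. *)
Lemma superlinear_growth (R : realType) (u : R -> R) (eps c N : R) :
  0 < eps -> 0 < c -> 0 < N ->
  (forall r, 0 < r -> derivable u r 1) ->
  (forall r, N <= r -> c * r `^ eps <= derive1 u r) ->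
  forall M, exists2 rho, 0 < rho & forall r, rho <= r -> M * r <= u r.
Proof.
move=> e0 c0 N0 ud ugrow M.
pose M1 := `|M| + 1.
have M10 : 0 < M1 by rewrite ltr_wpDl.
pose r0 := Num.max N ((M1 / c) `^ eps^-1).
have r00 : 0 < r0 by rewrite lt_max N0.
have steep r : r0 <= r -> M1 <= derive1 u r.
  rewrite /r0 ge_max => /andP[Nr Mr]; apply: le_trans (ugrow r Nr).
  rewrite mulrC -ler_pdivrMr //.
  have M1c : 0 <= M1 / c by rewrite divr_ge0 // ltW.
  have -> : M1 / c = ((M1 / c) `^ eps^-1) `^ eps.
    by rewrite -powRrM mulVf ?gt_eqF // powRr1.
  apply: ge0_ler_powR => //; rewrite ?nnegrE ?powR_ge0 ?ltW //.
  exact: lt_le_trans N0 Nr.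
pose rho := r0 + `|M1 * r0 - u r0|.
exists rho; first by rewrite ltr_wpDr.
move=> r rhor; have r0r : r0 <= r by apply: le_trans rhor; rewrite lerDl.
have [s] : exists2 s, s \in `[r0, r]%R & u r - u r0 = derive1 u s * (r - r0).
  apply: MVT_segment => // [s|].
    rewrite in_itv /= => /andP[r0s _]; rewrite derive1E; apply/derivableP/ud.
    exact: lt_trans r0s.
  apply: derivable_within_continuous => s; rewrite in_itv /= => /andP[r0s _].
  by apply: ud; exact: lt_le_trans r0s.
rewrite in_itv /= => /andP[/steep us _] E.
have : M1 * (r - r0) <= u r - u r0 by rewrite E ler_wpM2r // subr_ge0.
have Mr : M * r <= (M1 - 1) * r.
  by rewrite ler_wpM2r ?(le_trans (ltW r00)) // /M1 addrK ler_norm.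
have : M1 * r0 - u r0 <= r.
  apply: le_trans rhor; apply: le_trans (ler_norm _) _; rewrite lerDr ltW //.
lra.
Qed.

(** For r > 0 the profile is the restriction of the smooth function
    y |-> u |y| to a ray; here derive1 u r is a true derivative. *)
Lemma profile_derivable (R : realType) (n : nat) (u : R -> R) : (0 < n)%N ->
  smooth_on setT (fun y : 'rV[R]_n => u (enorm y)) ->
  forall r, 0 < r -> derivable u r 1.
Proof.
case: n => // n _ us r r0.
pose e : 'rV[R]_n.+1 := delta_mx 0 0.
have enorm_e (s : R) : enorm (s *: e) = `|s|.
  rewrite /enorm /dot big_ord_recl big1 => [|i _]; last by rewrite !mxE mulr0 mul0r.
  by rewrite !mxE eqxx mulr1 addr0 -expr2 sqrtr_sqr.
apply: (@near_eq_derivable _ _ _ (fun s : R => u (enorm (s *: e)))).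
  near=> s; rewrite enorm_e gtr0_norm //; near: s.
  exact: lt_nbhsr.
apply/derivable1_diffP.
apply: (@differentiable_comp _ _ _ _ (fun s : R => s *: e) (fun y => u (enorm y))) => //.
exact: (us [::]).
Unshelve. all: by end_near. Qed.

(** * Superlinear graphs are of Type IIb *)

Theorem theorem1p2 (R : realType) (n : nat) (hn : (2 <= n)%N) (u : R -> R)
  (u_smooth : smooth_on setT (fun y : 'rV[R]_n => u (enorm y)))
  (u_convex : convex_function (E := 'rV[R]_n) setT (fun y => u (enorm y)))
  (eps c N : R) (eps_gt0 : 0 < eps) (c_gt0 : 0 < c) (N_gt0 : 0 < N)
  (u_growth : forall r : R, N <= r -> c * r `^ eps <= derive1 u r)
  (x nu : R -> 'rV[R]_n -> 'rV[R]_(n + 1))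
  (x_mcf : longtime_mcf x nu)
  (x_init : initial_data x (entire_graph (fun y => u (enorm y)))) :
  typeIIb x nu.
Proof.
apply: contrapT => /curvature_bound_not_typeIIb[C0 AC0].
pose C := `|C0|.
have AC (t : R) p : 0 < t -> t * sqnormA (x t) (nu t) p <= C.
  by move=> t0; apply: le_trans (AC0 t p t0) (ler_norm _).
pose K2 : R := (n + 1)%:R * C.
have K20 : 0 <= K2 := mulr_ge0 (ler0n _ _) (normr_ge0 _).
have disp (t : R) p k : 0 <= t ->
    `|x t p 0 k - x 0 p 0 k| <= 2 * Num.sqrt K2 * Num.sqrt t.
  exact: displacement_le x nu C x_mcf AC t p k.
(* Along a trajectory z^2 grows at most like 8 K2 t, so this a keeps a z^2 below
   t / 4 up to a constant; the summand 2 gives a <= 1/2 even if K2 = 0. *)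
pose a : R := (32 * K2 + 2)^-1.
have a0 : 0 < a by rewrite invr_gt0; lra.
have a12 : a <= 2^-1 by rewrite lef_pV2 ?posrE //; lra.
have aK2 : 32 * a * K2 <= 1.
  have : a * (32 * K2 + 2) = 1 by rewrite mulVf // gt_eqF //; lra.
  nra.
have [emb rng] := x_init.
have U_cont : continuous (fun y : 'rV[R]_n => u (enorm y)).
  by move=> y; apply: differentiable_continuous; exact: (u_smooth [::]).
have u_der := profile_derivable R n u (ltnW hn) u_smooth.
have [rho1 rho10 sup1] := superlinear_growth R u eps c N eps_gt0 c_gt0 N_gt0 u_der u_growth (6 / a).
(* The slope 6 / a makes a / 2 * u^2 beat the term 2 r^2 left by
   cone_form_shift_le, and also bounds the barrier at time 0. *)
have steep r : rho1 <= r -> 18 * r ^+ 2 <= a / 2 * u r ^+ 2.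
  move=> rho1r; have r0 : 0 <= r by rewrite (le_trans (ltW rho10)).
  have ur := sup1 r rho1r.
  have ur0 : 0 <= 6 / a * r by rewrite mulr_ge0 // divr_ge0 // ltW.
  have : (6 / a * r) ^+ 2 <= u r ^+ 2 by rewrite lerXn2r // nnegrE // (le_trans ur0).
  move=> /(ler_wpM2l (ltW (divr_gt0 a0 (ltr0Sn R 1)))); apply: le_trans.
  have -> : a / 2 * (6 / a * r) ^+ 2 = 18 / a * r ^+ 2.
    by field; rewrite gt_eqF.
  rewrite ler_wpM2r ?sqr_ge0 // ler_pdivlMr //; lra.
(* The trajectory along which the barrier becomes too large. *)
pose p0 : 'rV[R]_n := 0.
pose z0 := x 0 p0 0 (rshift n 0).
pose B := rho1 ^+ 2.
(* By this time the barrier at p0 has grown to at least B + 1. *)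
pose T := 4 * (B + 2 * a * z0 ^+ 2 + 1).
have B0 : 0 <= B := sqr_ge0 _.
have az0 : 0 <= a * z0 ^+ 2 by rewrite mulr_ge0 ?sqr_ge0 // ltW.
have T0 : 0 < T by rewrite /T; lra.
have initial p : cone_form a (x 0 p) <= B.
  have : range (x 0) (x 0 p) by exists p.
  rewrite rng => -[y _ xy]; rewrite -xy cone_form_graph.
  have [yr|ry] := leP (enorm y) rho1.
    have : enorm y ^+ 2 <= B by rewrite lerXn2r // nnegrE ?enorm_ge0 // ltW.
    have : 0 <= a * u (enorm y) ^+ 2 by rewrite mulr_ge0 ?sqr_ge0 // ltW.
    lra.
  have := steep _ (ltW ry); have := sqr_ge0 (enorm y); lra.
have late : B < cone_form a (x T p0) + T / 2.
  have := cone_form_height_ge a (x T p0) (ltW a0).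
  set zT := x T p0 0 _.
  have zTz0 : (zT - z0) ^+ 2 <= 4 * K2 * T.
    have := disp T p0 (rshift n 0) (ltW T0); rewrite -/zT -/z0 => H.
    rewrite -real_normK ?num_real //.
    have -> : 4 * K2 * T = (2 * Num.sqrt K2 * Num.sqrt T) ^+ 2.
      by rewrite !exprMn !sqr_sqrtr ?(ltW T0) //; ring.
    by rewrite lerXn2r // nnegrE (le_trans _ H).
  have zT2 : zT ^+ 2 <= 2 * z0 ^+ 2 + 8 * K2 * T.
    have := sqr_ge0 (zT - 2 * z0); move: zTz0; rewrite !expr2; nra.
  have azT : a * zT ^+ 2 <= 2 * (a * z0 ^+ 2) + T / 4.
    have := ler_wpM2l (ltW a0) zT2.
    have := ler_wpM2r (ltW T0) aK2.
    nra.
  have TB : T / 4 = B + 2 * (a * z0 ^+ 2) + 1 by rewrite /T; field.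
  lra.
pose d := 2 * Num.sqrt K2 * Num.sqrt T.
pose E := (2 * n%:R + a) * d ^+ 2 + T / 2.
have E0 : 0 <= E.
  have na0 : 0 <= 2 * n%:R + a by have := ler0n R n; lra.
  have T20 : 0 <= T / 2 by lra.
  exact: addr_ge0 (mulr_ge0 na0 (sqr_ge0 d)) T20.
have [K K_compact K_far] :=
  far_outside_compact R n (fun y => u (enorm y)) (x 0) (rho1 + E + 1) U_cont emb rng.
(* Beyond radius rho1 + E + 1 the term - 16 |y|^2 outweighs the error E. *)
have far (t : R) p : 0 <= t <= T -> ~ K p -> cone_form a (x t p) + t / 2 <= B.
  move=> /andP[t0 tT] /K_far[y xy yr].
  have xtx0 k : `|x t p 0 k - x 0 p 0 k| <= d.
    apply: le_trans (disp t p k t0) _.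
    by rewrite ler_wpM2l ?mulr_ge0 ?sqrtr_ge0 // ler_wsqrtr.
  have := cone_form_shift_le a (x 0 p) (x t p) d (ltW a0) xtx0.
  rewrite xy row_mxEr mxE eqxx mulr1n.
  under eq_bigr do rewrite row_mxEl.
  rewrite -enorm_sqr => shift.
  have rho1y : rho1 <= enorm y by lra.
  have := steep _ rho1y => st.
  have r1 : 1 <= enorm y by lra.
  have : enorm y <= enorm y ^+ 2 by rewrite expr2 ler_peMl //; lra.
  have : t / 2 <= T / 2 by rewrite ler_wpM2r.
  move: B0 shift st yr; rewrite /E; lra.
have a01 : 0 <= a <= 2^-1 by rewrite ltW.
have := barrier_le x nu a T B K x_mcf hn a01 (ltW T0) K_compact far initial p0.
by rewrite leNgt late.
Qed.
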